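(* Let a real Lie group $G$ have a $C^\infty$ action on a manifold $M$. Assume the $G$-action on $M$ is component effective. Assume, for all $q\in M$, that $\mathrm{Stab}_G(q)$ is compact. Let $\ell\in\{1,2,3,\ldots\}$. Then the (prolonged) $G$-action on $\mathcal F^\ell M$ is free.
   Context: Manifolds are $C^\infty$ real manifolds (not assumed connected). Actions are left actions. $\mathrm{Stab}_G(x):=\{g\in G\mid gx=x\}$. $\mathcal F^kM$ denotes the $k$th order frame bundle of $M$: its points over $p\in M$ are the $k$-jets at $0$ of local diffeomorphisms $\varphi$ from a neighborhood of $0$ in $\mathbb R^{\dim M}$ to $M$ with $\varphi(0)=p$. A $C^\infty$ action of $G$ on $M$ induces (by differentiation, ''prolongation'') a $G$-action on $\mathcal F^kM$, $g\cdot j^k_0\varphi=j^k_0(g\circ\varphi)$. An action of a group $G$ on a topological space $X$ is component effective if, for every $g\in G\setminus\{1_G\}$ and every connected component $X^\circ$ of $X$, there exists $x\in X^\circ$ such that $gx\ne x$. *)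

(* Defs.v *)
From HB Require Import structures.
From mathcomp Require Import all_boot all_order all_algebra.
From mathcomp Require Import all_classical all_reals all_analysis.

Set Implicit Arguments.
Unset Strict Implicit.
Unset Printing Implicit Defensive.

Import Order.TTheory GRing.Theory Num.Theory.
Import numFieldNormedType.Exports.

Local Open Scope classical_set_scope.
Local Open Scope ring_scope.

(* C^k and C^oo maps between normed spaces, on an open set A: f is C^{k+1} on A
   when it is differentiable on A and all its directional derivatives are C^k
   on A. *)
Fixpoint Ck_on (R : realType) (V W : normedModType R) (k : nat)
    (A : set V) (f : V -> W) : Prop :=
  match k with
  | 0 => forall x, A x -> {for x, continuous f}
  | k'.+1 => (forall x, A x -> differentiable f x) /\
             (forall v : V, Ck_on k' A (fun x => 'D_v f x))
  end.

Definition Cinfty_on (R : realType) (V W : normedModType R)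
    (A : set V) (f : V -> W) : Prop :=
  forall k, Ck_on k A f.

(* A homeomorphism from an open subset of M onto an open subset of V. The map
   and its inverse are total functions whose values outside chart_dom and
   chart_fun @` chart_dom are irrelevant. *)
Record chart (R : realType) (V : normedModType R) (M : topologicalType) :=
  Chart {
    chart_dom : set M ;
    chart_fun :> M -> V ;
    chart_inv : V -> M ;
    chart_dom_open : open chart_dom ;
    chart_img_open : open (chart_fun @` chart_dom) ;
    chart_funK : forall x, chart_dom x -> chart_inv (chart_fun x) = x ;
    chart_fun_continuous :
      forall x, chart_dom x -> {for x, continuous chart_fun} ;
    chart_inv_continuous :
      forall u, (chart_fun @` chart_dom) u -> {for u, continuous chart_inv}
  }.

Program Definition id_chart (R : realType) (V : normedModType R) : chart V V :=
  @Chart R V V setT id id _ _ _ _ _.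
Next Obligation. by move=> R V; exact: openT. Qed.
Next Obligation. by move=> R V; rewrite image_id; exact: openT. Qed.
Next Obligation. by []. Qed.
Next Obligation. by move=> R V x _; exact: cvg_id. Qed.
Next Obligation. by move=> R V u _; exact: cvg_id. Qed.

Lemma image_prod_setX (T1 T2 U1 U2 : Type) (f1 : T1 -> U1) (f2 : T2 -> U2)
    (A1 : set T1) (A2 : set T2) :
  (fun x : T1 * T2 => (f1 x.1, f2 x.2)) @` (A1 `*` A2) =
  (f1 @` A1) `*` (f2 @` A2).
Proof.
apply/seteqP; split=> [_ [[x y] [/= Ax Ay] <-]|[u v] [/= [x Ax <-] [y Ay <-]]].
  by split; [exists x|exists y].
by exists (x, y).
Qed.

Lemma continuous_prod_map (T1 T2 U1 U2 : topologicalType)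
    (f1 : T1 -> U1) (f2 : T2 -> U2) (x : T1 * T2) :
  {for x.1, continuous f1} -> {for x.2, continuous f2} ->
  {for x, continuous (fun x : T1 * T2 => (f1 x.1, f2 x.2))}.
Proof.
case: x => x y /= f1x f2x; apply: cvg_pair.
  apply: (@cvg_comp _ _ _ fst f1 _ (nbhs x)); [exact: cvg_fst|exact: f1x].
apply: (@cvg_comp _ _ _ snd f2 _ (nbhs y)); [exact: cvg_snd|exact: f2x].
Qed.

Lemma open_setX (T1 T2 : topologicalType) (A1 : set T1) (A2 : set T2) :
  open A1 -> open A2 -> open (A1 `*` A2).
Proof.
rewrite !openE => o1 o2 [x y] [/= A1x A2y].
by exists (A1, A2) => //=; split; [exact: o1|exact: o2].
Qed.

Section ProdChart.
Variables (R : realType) (V1 V2 : normedModType R) (M1 M2 : topologicalType).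
Variables (c1 : chart V1 M1) (c2 : chart V2 M2).

Let dom := chart_dom c1 `*` chart_dom c2.
Let fwd (x : M1 * M2) : V1 * V2 := (c1 x.1, c2 x.2).
Let bwd (u : V1 * V2) : M1 * M2 := (chart_inv c1 u.1, chart_inv c2 u.2).

Program Definition prod_chart : chart (V1 * V2)%type (M1 * M2)%type :=
  @Chart R (V1 * V2)%type (M1 * M2)%type dom fwd bwd _ _ _ _ _.
Next Obligation. by apply: open_setX; exact: chart_dom_open. Qed.
Next Obligation.
by rewrite /fwd image_prod_setX; apply: open_setX; exact: chart_img_open.
Qed.
Next Obligation.
by move=> [x y] [/= dx dy]; rewrite /bwd /fwd /= !chart_funK.
Qed.
Next Obligation.
by move=> x [dx dy]; apply: continuous_prod_map; exact: chart_fun_continuous.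
Qed.
Next Obligation.
move=> u; rewrite /fwd image_prod_setX => -[iu iv].
by apply: continuous_prod_map; exact: chart_inv_continuous.
Qed.

End ProdChart.

Definition model_atlas (R : realType) (V : normedModType R) : set (chart V V) :=
  [set @id_chart R V].
Arguments model_atlas {R} V.

Definition prod_atlas (R : realType) (V1 V2 : normedModType R)
    (M1 M2 : topologicalType) (a1 : set (chart V1 M1)) (a2 : set (chart V2 M2)) :
    set (chart (V1 * V2)%type (M1 * M2)%type) :=
  [set c | exists c1 c2, [/\ a1 c1, a2 c2 & c = prod_chart c1 c2]].

(* Smoothness of f on the open set A, with respect to atlases of its domain and
   of its codomain. *)
Definition smooth_on (R : realType) (V W : normedModType R)
    (M N : topologicalType) (aM : set (chart V M)) (aN : set (chart W N))
    (A : set M) (f : M -> N) : Prop :=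
  (forall x, A x -> {for x, continuous f}) /\
  (forall (c : chart V M) (d : chart W N), aM c -> aN d ->
     Cinfty_on (c @` (A `&` chart_dom c `&` f @^-1` chart_dom d))
               (d \o f \o chart_inv c)).

(* Smooth manifolds of dimension n. The smooth structure is given by an atlas,
   not required to be maximal. *)
HB.mixin Record isManifold (R : realType) (n : nat) M of Topological M := {
  atlas : set (chart 'rV[R]_n M) ;
  atlas_cover : forall x : M, exists2 c, atlas c & chart_dom c x ;
  atlas_compatible : forall c d, atlas c -> atlas d ->
    Cinfty_on (c @` (chart_dom c `&` chart_dom d)) (d \o chart_inv c) ;
  manifold_hausdorff : hausdorff_space M ;
  manifold_second_countable : @second_countable M
}.

#[short(type="manifoldType")]
HB.structure Definition Manifold (R : realType) (n : nat) :=
  {M of Topological M & isManifold R n M}.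

Arguments atlas {R n} s.

HB.mixin Record isLieGroup (R : realType) (n : nat) G
    of Group G & Manifold R n G := {
  mulg_smooth : smooth_on
    (prod_atlas (atlas (G : manifoldType R n)) (atlas (G : manifoldType R n)))
    (atlas (G : manifoldType R n)) setT (fun gh : G * G => (gh.1 * gh.2)%g) ;
  invg_smooth : smooth_on
    (atlas (G : manifoldType R n)) (atlas (G : manifoldType R n)) setT
    (fun g : G => (g^-1)%g)
}.

#[short(type="lieGroupType")]
HB.structure Definition LieGroup (R : realType) (n : nat) :=
  {G of Group G & Manifold R n G & isLieGroup R n G}.

Definition left_action (G : groupType) (X : Type) (act : G -> X -> X) : Prop :=
  (forall x, act 1%g x = x) /\
  (forall g h x, act (g * h)%g x = act g (act h x)).

Definition smooth_action (R : realType) (d n : nat) (G : lieGroupType R d)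
    (M : manifoldType R n) (act : G -> M -> M) : Prop :=
  left_action act /\
  smooth_on (prod_atlas (atlas G) (atlas M)) (atlas M) setT
    (fun gx : G * M => act gx.1 gx.2).

Definition stabilizer (G X : Type) (act : G -> X -> X) (x : X) : set G :=
  [set g | act g x = x].

(* Freeness of the action on the subset A of X. *)
Definition free_on (G : groupType) (X : Type) (act : G -> X -> X) (A : set X) :
    Prop :=
  forall x, A x -> stabilizer act x = [set 1%g].

Definition component_effective (G : groupType) (X : topologicalType)
    (act : G -> X -> X) : Prop :=
  forall g : G, g <> 1%g ->
  forall C : set X, (exists x, C = connected_component setT x) ->
  exists2 x, C x & act g x <> x.

Definition iter_derive (R : realType) (V W : normedModType R) (vs : seq V)
    (f : V -> W) : V -> W :=
  foldr (fun v h x => 'D_v h x) f vs.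

Section Frames.
Variables (R : realType) (n : nat) (M : manifoldType R n).
Implicit Types phi psi : 'rV[R]_n -> M.

(* phi restricts to a diffeomorphism from a neighborhood of 0 onto an open
   subset of M. Elsewhere its values are irrelevant: only its germ at 0 is ever
   used. *)
Definition local_diffeo0 phi : Prop :=
  exists (U : set 'rV[R]_n) (inv : M -> 'rV[R]_n),
    [/\ open U /\ U 0,
        open (phi @` U),
        forall u, U u -> inv (phi u) = u,
        smooth_on (model_atlas 'rV[R]_n) (atlas M) U phi &
        smooth_on (atlas M) (model_atlas 'rV[R]_n) (phi @` U) inv].

Definition same_jet0 (k : nat) phi psi : Prop :=
  phi 0 = psi 0 /\
  forall c, atlas M c -> chart_dom c (phi 0) ->
  forall vs : seq 'rV[R]_n, (size vs <= k)%N ->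
    iter_derive vs (c \o phi) 0 = iter_derive vs (c \o psi) 0.

Definition jet0 (k : nat) phi : set ('rV[R]_n -> M) :=
  [set psi | local_diffeo0 psi /\ same_jet0 k phi psi].

(* The total space of the k-th order frame bundle of M, a k-jet at 0 being
   represented by the set of all local diffeomorphisms having that k-jet. *)
Definition frame_bundle (k : nat) : set (set ('rV[R]_n -> M)) :=
  [set J | exists2 phi, local_diffeo0 phi & J = jet0 k phi].

(* The map j^k_0 phi |-> j^k_0 (f o phi) induced by a diffeomorphism f of M.
   By the chain rule jet0 k (f \o phi) is the same set for all phi in a given
   jet J, so that the union below is that set. *)
Definition prolong (k : nat) (f : M -> M) (J : set ('rV[R]_n -> M)) :
    set ('rV[R]_n -> M) :=
  \bigcup_(phi in J) jet0 k (f \o phi).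

End Frames.
Arguments frame_bundle {R n} M k.

(* Main.v *)
Require Import Defs.
From HB Require Import structures.
From mathcomp Require Import all_boot all_order all_algebra.
From mathcomp Require Import all_classical all_reals all_analysis.
From mathcomp Require Import lra.

Set Implicit Arguments.
Unset Strict Implicit.
Unset Printing Implicit Defensive.

Import Order.TTheory GRing.Theory Num.Theory.
Import numFieldNormedType.Exports.
Local Open Scope classical_set_scope.
Local Open Scope ring_scope.

(** Let g fix the 1-jet of a frame at p: then g p = p, and in a chart centred
    at p the derivative of g at p is the identity. The powers of g lie in the
    compact group Stab(p), so all of them are, on one common ball around p,
    within distance 1/2 (in operator norm of the derivative) of their
    derivatives at p, that is, of the identity. For x near p and v = g x - x
    this gives |g^(k+1) x - g^k x - v| <= |v| / 2 for every k; as the orbit of x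
    under the powers of g stays in a bounded set, summing over k forces v = 0.
    Hence g is the identity near p. The same argument shows that the interior of
    the fixed point set of g, which is open, is closed as well: at a limit point
    the derivative of g is still the identity, by continuity. So g fixes a whole
    connected component, and component effectiveness gives g = 1. *)

(** * Directional derivatives and mean value estimates *)

Lemma is_derive_along_line (R : realType) (V W : normedModType R) (f : V -> W)
    (x v : V) (t : R) : derivable f (x + t *: v) v ->
  is_derive t 1 (fun s : R => f (x + s *: v)) ('D_v f (x + t *: v)).
Proof.
set g := fun s : R => f (x + s *: v).
have quotE : (fun h : R => h^-1 *: ((g \o shift t) (h *: (1 : R)) - g t)) =
    (fun h : R =>
      h^-1 *: ((f \o shift (x + t *: v)) (h *: v) - f (x + t *: v))).
  apply/funext => h; rewrite /g /=; congr (_ *: (f _ - _)).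
  by rewrite [_%:A]mulr1 scalerDl addrCA.
move=> df; apply: DeriveDef; first by rewrite /derivable quotE.
by rewrite /derive quotE.
Qed.

(** An exact mean value theorem holds only for real-valued functions, so it is applied to one
    coordinate at a time; the point [t] depends on [i]. *)
Lemma MVT_coord (R : realType) (V : normedModType R) (n : nat)
    (f : V -> 'rV[R]_n) (x y : V) (i : 'I_n) :
  (forall t : R, 0 <= t <= 1 -> differentiable f (x + t *: (y - x))) ->
  exists2 t : R, 0 <= t <= 1 &
    (f y - f x) ord0 i = 'D_(y - x) f (x + t *: (y - x)) ord0 i.
Proof.
move=> df; pose phi (s : R) := f (x + s *: (y - x)).
have dphi (t : R) : 0 <= t <= 1 -> is_derive t 1 (fun s => phi s ord0 i)
    ('D_(y - x) f (x + t *: (y - x)) ord0 i).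
  move=> t01.
  have [dphi <-] := is_derive_along_line (diff_derivable (df _ t01)).
  apply: DeriveDef; first by move/derivable_mxP: dphi; apply.
  by rewrite (derive_mx dphi) mxE.
have [c||t t01 e] := @MVT_segment R (fun s => phi s ord0 i)
    (fun t => 'D_(y - x) f (x + t *: (y - x)) ord0 i) 0 1 ler01.
- rewrite in_itv/= => /andP[c0 c1]; apply: dphi.
  by rewrite !ltW.
- apply: derivable_within_continuous => t; rewrite in_itv/= => /dphi.
  by case.
exists t; first by rewrite in_itv/= in t01.
move: e; rewrite subr0 mulr1 /phi scale1r scale0r addr0 subrKC => <-.
by rewrite !mxE.
Qed.

Lemma norm_coord_le (R : realType) (n : nat) (v : 'rV[R]_n) (i : 'I_n) :
  `|v ord0 i| <= `|v|.
Proof.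
rewrite [leRHS]/Num.Def.normr/= mx_normrE.
exact: (le_bigmax _ (fun i : 'I_1 * 'I_n => `|v i.1 i.2|) (ord0, i)).
Qed.

Lemma norm_rV_le (R : realType) (n : nat) (v : 'rV[R]_n) (a : R) :
  0 <= a -> (forall i, `|v ord0 i| <= a) -> `|v| <= a.
Proof.
move=> a0 va; rewrite [leLHS]/Num.Def.normr/= mx_normrE bigmax_le// => -[j i] _.
by rewrite (ord1 j).
Qed.

Lemma derive_row_sum (R : realType) (W : normedModType R) (n : nat)
    (f : 'rV[R]_n -> W) (x v : 'rV[R]_n) : differentiable f x ->
  'D_v f x = \sum_j v ord0 j *: 'D_('e_j) f x.
Proof.
move=> df; rewrite {1}(row_sum_delta v) deriveE// linear_sum.
by apply: eq_bigr => j _; rewrite linearZ deriveE.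
Qed.

Lemma derive_comp (R : realType) (U V W : normedModType R) (f : U -> V)
    (g : V -> W) (x v : U) : differentiable f x -> differentiable g (f x) ->
  'D_v (g \o f) x = 'D_('D_v f x) g (f x).
Proof.
move=> df dg; rewrite (deriveE _ dg) (deriveE _ df).
by rewrite (deriveE _ (differentiable_comp df dg)) (diff_comp df dg).
Qed.

Lemma is_derive_section (R : realType) (V1 V2 W : normedModType R)
    (f : V1 * V2 -> W) (a : V1) (u w : V2) : derivable f (a, u) (0, w) ->
  is_derive u w (fun y => f (a, y)) ('D_(0, w) f (a, u)).
Proof.
have quotE : (fun h : R => h^-1 *:
      (((fun y => f (a, y)) \o shift u) (h *: w) - f (a, u))) =
    (fun h : R => h^-1 *: ((f \o shift (a, u)) (h *: (0, w)) - f (a, u))).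
  apply/funext => h /=; congr (_ *: (f _ - _)); congr (_, _).
  by rewrite /= scaler0 add0r.
move=> df; apply: DeriveDef; first by rewrite /derivable quotE.
by rewrite /derive quotE.
Qed.

Lemma differentiable_section (R : realType) (V1 V2 W : normedModType R)
    (f : V1 * V2 -> W) (a : V1) (u : V2) : differentiable f (a, u) ->
  differentiable (fun y => f (a, y)) u.
Proof.
by move=> df; apply: (@differentiable_comp _ _ _ _ (fun y => (a, y)) f).
Qed.

Lemma ball_segment (R : realType) (V : normedModType R) (c x y : V) (r t : R) :
  0 <= t <= 1 -> ball c r x -> ball c r y -> ball c r (x + t *: (y - x)).
Proof.
rewrite -!ball_normE /ball_/= => /andP[t0 t1] xr yr.
have -> : c - (x + t *: (y - x)) = (1 - t) *: (c - x) + t *: (c - y).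
  rewrite scalerBl scale1r -[RHS]addrA -scalerN -scalerDr opprB subrKA.
  by rewrite opprD -scalerN opprB addrA.
apply: (le_lt_trans (ler_normD _ _)); rewrite !normrZ ger0_norm ?subr_ge0//.
(* The bound on [y] stays strict after multiplication by [t] only when [t > 0]; at [t = 0] the point
   is [x] itself. *)
rewrite (ger0_norm t0); have [->|tn0] := eqVneq t 0.
  by rewrite subr0 mul1r mul0r addr0.
have tp : 0 < t by rewrite lt_def tn0.
have : t * `|c - y| < t * r by rewrite ltr_pM2l.
have : (1 - t) * `|c - x| <= (1 - t) * r by rewrite ler_wpM2l ?subr_ge0// ltW.
lra.
Qed.

(** Joint continuity keeps the partial derivatives in the second variable close to their values at
    [(a0, u0)], for all [(a, u)] nearby; the mean value theorem in each coordinate turns this into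
    the estimate. One radius thus serves all parameters near [a0], which prepares a compactness
    argument over group elements. *)
Lemma C1_family_linear_approx (R : realType) (V : normedModType R) (n m : nat)
    (f : V * 'rV[R]_n -> 'rV[R]_m) (A : set (V * 'rV[R]_n))
    (a0 : V) (u0 : 'rV[R]_n) (e : R) :
  open A -> A (a0, u0) -> Ck_on 1 A f -> 0 < e ->
  \forall a \near a0 & r \near 0^'+, forall x y,
    ball u0 r x -> ball u0 r y ->
    `|f (a, y) - f (a, x) - 'D_(y - x) (fun u => f (a, u)) u0| <= e * `|y - x|.
Proof.
move=> Aop Aau [df cdf] e0.
(* Each of the [n] partial derivatives is compared with its value at [(a0, u0)] twice, once at [u]
   and once at [u0], which costs [d + d = e / n.+1]. The successor keeps [d] meaningful when
   [n = 0]. *)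
pose d := e / 2 / n.+1%:R.
have d0 : 0 < d by rewrite !divr_gt0.
have : \forall p \near (a0, u0), A p /\ forall j : 'I_n,
    `|'D_(0, 'e_j) f (a0, u0) - 'D_(0, 'e_j) f p| <= d.
  apply: filterI; first exact: open_nbhs_nbhs.
  apply: (@filter_forall _ _ _ (nbhs (a0, u0))) => j.
  by have /cvgrPdist_le := cdf (0, 'e_j) _ Aau; apply.
move=> /nbhs_ballP[rho /= rho0 Hrho].
exists (ball a0 rho, [set r | 0 < r < rho]).
  split; first exact: nbhsx_ballx.
  near=> r => /=; apply/andP; split; near: r.
  - exact: nbhs_right_gt.
  - exact: nbhs_right_lt.
move=> [a r] [/= aa0 /andP[r0 rrho]] x y xr yr.
have ballA u : ball u0 r u -> A (a, u) /\ forall j : 'I_n,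
    `|'D_(0, 'e_j) f (a0, u0) - 'D_(0, 'e_j) f (a, u)| <= d.
  move=> ur; apply: Hrho; split => //=.
  by apply: le_ball ur; exact: ltW.
have dsec u : ball u0 r u -> differentiable (fun u => f (a, u)) u.
  by move=> /ballA[/df/differentiable_section].
have u0r : ball u0 r u0 by exact: ballxx.
have derB u v : ball u0 r u -> `|'D_v (fun u => f (a, u)) u -
    'D_v (fun u => f (a, u)) u0| <= e * `|v|.
  move=> ur; rewrite (derive_row_sum _ (dsec _ ur)).
  rewrite (derive_row_sum _ (dsec _ u0r)) -sumrB.
  have bnd j : `|v ord0 j *: 'D_('e_j) (fun u => f (a, u)) u -
      v ord0 j *: 'D_('e_j) (fun u => f (a, u)) u0| <= `|v| * (d + d).
    rewrite -scalerBr normrZ ler_pM ?norm_coord_le//.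
    have dq w : ball u0 r w -> 'D_('e_j) (fun u => f (a, u)) w =
        'D_(0, 'e_j) f (a, w).
      move=> /ballA[/df/diff_derivable df' _].
      exact: (derive_val (is_derive := is_derive_section (df' _))).
    rewrite !dq// -(subrKA ('D_(0, 'e_j) f (a0, u0))).
    apply: (le_trans (ler_normD _ _)); apply: lerD; last exact: (ballA _ u0r).2.
    by rewrite distrC; apply: (ballA _ ur).2.
  apply: (le_trans (ler_norm_sum _ _ _)).
  apply: (le_trans (ler_sum _ (fun j _ => bnd j))).
  rewrite sumr_const card_ord -mulr_natr -mulrA [leRHS]mulrC ler_wpM2l//.
  have -> : d + d = e / n.+1%:R by rewrite /d -mulrDl -splitr.
  by rewrite mulrAC ler_pdivrMr// ler_pM2l// ler_nat.
apply: norm_rV_le => [|i]; first by rewrite mulr_ge0// ltW.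
have [t t01 Ei] := @MVT_coord R _ m (fun u => f (a, u)) x y i
  (fun t t01 => dsec _ (ball_segment t01 xr yr)).
rewrite mxE {}Ei.
apply: le_trans (derB _ (y - x) (ball_segment t01 xr yr)).
apply: le_trans (norm_coord_le _ i).
by rewrite !mxE.
Unshelve. all: by end_near. Qed.

(** Summing the steps, [z k - z 0] differs from [v *+ k] by at most [k |v| / 2], so its norm is at
    least [k |v| / 2]. This is unbounded in [k] unless [v = 0]. *)
Lemma bounded_near_arithmetic (R : realType) (V : normedModType R)
    (z : nat -> V) (v : V) (b : R) :
  (forall k, `|z k.+1 - z k - v| <= 2^-1 * `|v|) ->
  (forall k, `|z k - z 0%N| <= b) -> v = 0.
Proof.
move=> zstep zb.
have ztel k : `|z k - z 0%N - v *+ k| <= (2^-1 * `|v|) *+ k.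
  elim: k => [|k IH]; first by rewrite subrr subr0 normr0.
  rewrite !(mulrS _ k); apply: le_trans (lerD (zstep k) IH).
  apply: le_trans (ler_normD _ _); rewrite le_eqVlt; apply/orP; left; apply/eqP.
  by congr `|_|; rewrite opprD [RHS]addrACA subrKA.
have bnd k : `|v| * k%:R <= b + 2^-1 * `|v| * k%:R.
  rewrite !mulr_natr -normrMn; apply: le_trans (lerD (zb k) (ztel k)).
  rewrite [X in _ <= _ + X]distrC; apply: le_trans (ler_normD _ _).
  by rewrite subrKC.
have b0 : 0 <= b := le_trans (normr_ge0 _) (zb 0%N).
apply/eqP; rewrite -normr_eq0; apply/negP => /negP v0.
have {}v0 : 0 < `|v| by rewrite lt_def v0 normr_ge0.
(* For such a [k] the lower bound [k |v| / 2] exceeds [b]. *)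
have [k] : exists k : nat, 2 * b / `|v| < k%:R.
  exists (Num.bound (2 * b / `|v|)); apply: archi_boundP.
  by rewrite divr_ge0 ?mulr_ge0.
rewrite ltr_pdivrMr// [ltRHS]mulrC; move: (bnd k); rewrite -mulrA.
move: (`|v| * _) => m; lra.
Qed.

(** * Closures and connected components *)

Lemma eq_closure_continuous (T U : topologicalType) (f g : T -> U) (A : set T)
    (x : T) : hausdorff_space U ->
  {for x, continuous f} -> {for x, continuous g} -> closure A x ->
  (\forall y \near x, A y -> f y = g y) -> f x = g x.
Proof.
move=> hU fx gx Ax fg; apply: hU => P Q /fx nP /gx nQ.
have [y [Ay [Py [Qy fgy]]]] : A `&` [set y | P (f y) /\ (Q (g y) /\
    (A y -> f y = g y))] !=set0.
  by apply: Ax; apply: filterI => //; exact: filterI.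
by exists (f y); split => //; rewrite fgy.
Qed.

Lemma connected_component_clopen (T : topologicalType) (A : set T) (x : T) :
  clopen A -> A x -> connected_component setT x `<=` A.
Proof.
move=> [Aop Acl] Ax.
have <- : connected_component setT x `&` A = connected_component setT x.
  apply: (@component_connected T setT x).
  - by exists x; split => //; exact: connected_component_refl.
  - by exists A.
  - by exists A.
exact: subIsetr.
Qed.

(** * Charts, and self-maps read in a chart *)

Lemma chart_invK (R : realType) (V : normedModType R) (M : topologicalType)
    (c : chart V M) (u : V) : (c @` chart_dom c) u -> c (chart_inv c u) = u.
Proof. by move=> [x cx <-]; rewrite chart_funK. Qed.

Lemma chart_inv_dom (R : realType) (V : normedModType R) (M : topologicalType)
    (c : chart V M) (u : V) :
  (c @` chart_dom c) u -> chart_dom c (chart_inv c u).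
Proof. by move=> [x cx <-]; rewrite chart_funK. Qed.

Lemma near_chart_img (R : realType) (V : normedModType R) (M : topologicalType)
    (c : chart V M) (u : V) :
  (c @` chart_dom c) u -> \forall v \near u, (c @` chart_dom c) v.
Proof.
by move=> cu; apply: open_nbhs_nbhs; split => //; exact: chart_img_open.
Qed.

Lemma near_chart_dom (R : realType) (V : normedModType R) (M : topologicalType)
    (c : chart V M) (x : M) : chart_dom c x -> \forall y \near x, chart_dom c y.
Proof.
by move=> cx; apply: open_nbhs_nbhs; split => //; exact: chart_dom_open.
Qed.

Lemma open_chart_img (R : realType) (V : normedModType R) (M : topologicalType)
    (c : chart V M) (A : set M) :
  open A -> A `<=` chart_dom c -> open (c @` A).
Proof.
move=> Aop Ac; rewrite openE => _ [x Ax <-].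
have cx : (c @` chart_dom c) (c x) by exists x => //; exact: Ac.
have nA : \forall v \near c x, A (chart_inv c v).
  apply: (chart_inv_continuous cx); rewrite chart_funK; last exact: Ac.
  exact: open_nbhs_nbhs.
near=> v; exists (chart_inv c v); first by near: v.
by apply: chart_invK; near: v; exact: near_chart_img.
Unshelve. all: by end_near. Qed.

Definition local_rep (R : realType) (V : normedModType R) (M : topologicalType)
    (c : chart V M) (f : M -> M) : V -> V := c \o f \o chart_inv c.

(** Off this set [local_rep c f] may involve the arbitrary values that [c] and [chart_inv c] take
    outside their domains. *)
Definition local_rep_dom (R : realType) (V : normedModType R)
    (M : topologicalType) (c : chart V M) (f : M -> M) : set V :=
  [set u | (c @` chart_dom c) u /\ chart_dom c (f (chart_inv c u))].

(** * Smooth actions near a fixed point *)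

Section SmoothAction.
Context (R : realType) (d n : nat) (G : lieGroupType R d).
Context (M : manifoldType R n) (act : G -> M -> M).
Context (act_smooth : smooth_action act).

Lemma smooth_action_continuous (p : G * M) :
  {for p, continuous (fun gx : G * M => act gx.1 gx.2)}.
Proof. by case: act_smooth => _ [+ _]; apply. Qed.

Lemma smooth_action_continuousr (g : G) : continuous (act g).
Proof.
move=> x; apply: (@cvg_comp _ _ _ (fun y => (g, y)) (fun gx => act gx.1 gx.2)).
  apply: (@cvg_pair _ _ _ (nbhs x) (nbhs g) (nbhs x)); first exact: cvg_cst.
  exact: cvg_id.
exact: (@smooth_action_continuous (g, x)).
Qed.

(** The action is read in the product of the charts [e] and [c], hence jointly in the group element
    and the point. The equivalence serves to pass between the joint domain [A] and the domain of a
    single [act g]. *)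
Lemma smooth_action_C1 (c : chart 'rV[R]_n M) (h : G) : atlas M c ->
  exists (e : chart 'rV[R]_d G) (A : set ('rV[R]_d * 'rV[R]_n)),
  [/\ chart_dom e h, open A,
      forall g u, chart_dom e g ->
        A (e g, u) <-> local_rep_dom c (act g) u &
      Ck_on 1 A (fun p => local_rep c (act (chart_inv e p.1)) p.2)].
Proof.
move=> cM; have [e eG eh] := atlas_cover h; exists e.
have [_ [_ /(_ (prod_chart e c) c)]] := act_smooth.
set A := _ @` _ => smA; exists A; split => //.
- apply: open_chart_img; last by move=> x [[]].
  apply: openI; first by rewrite setTI; exact: chart_dom_open.
  apply: open_comp; last exact: chart_dom_open.
  by move=> p _; exact: smooth_action_continuous.
- move=> g u eg; split.
    move=> [[g' x] [[_ [/= eg' cx]]] /= cgx [egg' <-]].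
    have {}egg' : g' = g by rewrite -(chart_funK eg') egg' chart_funK.
    by subst g'; split; [exists x|rewrite chart_funK].
  move=> [cu cgu]; exists (g, chart_inv c u) => /=.
    by split=> //; split=> //; split => //=; exact: chart_inv_dom.
  by rewrite chart_invK.
- by apply: (smA _ _ 1%N) => //; exists e, c.
Qed.

(** With the group coordinate frozen at [e g], the derivative along [w] is the derivative of the
    joint map along [(0, w)], whose continuity restricts to the slice. *)
Lemma local_rep_act_C1 (c : chart 'rV[R]_n M) (g : G) : atlas M c ->
  Ck_on 1 (local_rep_dom c (act g)) (local_rep c (act g)).
Proof.
move=> /(smooth_action_C1 g)[e [A [eg Aop AE [dF cF]]]].
have repE : local_rep c (act g) =
    fun u => local_rep c (act (chart_inv e (e g, u).1)) (e g, u).2.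
  by rewrite /= chart_funK.
have dq u w : local_rep_dom c (act g) u -> 'D_w (local_rep c (act g)) u =
    'D_(0, w) (fun p => local_rep c (act (chart_inv e p.1)) p.2) (e g, u).
  move=> /(AE _ _ eg)/dF/diff_derivable dFu; rewrite [in LHS]repE.
  exact: (derive_val (is_derive := is_derive_section (dFu _))).
split=> [u /(AE _ _ eg)/dF/differentiable_section|w u gu].
  by rewrite -repE.
have nA : \forall v \near u, A (e g, v).
  have : nbhs (e g, u) A by apply: open_nbhs_nbhs; split => //; exact/AE.
  move=> [[/= P Q] [Pg Qu] PQ]; apply: filterS Qu => v Qv; apply: PQ.
  by split => //=; exact: nbhs_singleton.
rewrite /prop_for /continuous_at dq//.
have eqD : \forall v \near u,
    'D_(0, w) (fun p => local_rep c (act (chart_inv e p.1)) p.2) (e g, v) =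
    'D_w (local_rep c (act g)) v.
  by apply: filterS nA => v /(AE _ _ eg)/dq ->.
apply: cvg_trans (near_eq_cvg eqD) _.
apply: (@cvg_comp _ _ _ (fun v => (e g, v))
  ('D_(0, w) (fun p => local_rep c (act (chart_inv e p.1)) p.2))).
  apply: (@cvg_pair _ _ _ (nbhs u) (nbhs (e g)) (nbhs u)); first exact: cvg_cst.
  exact: cvg_id.
by apply: cF; exact/AE.
Unshelve. all: by end_near. Qed.

(** Letting [g] tend to [h] together with [r] tending to [0] is the form that the near-covering
    characterisation of compactness takes as input; [act_near_linear] has it for the same reason. *)
Lemma act_near_ball (c : chart 'rV[R]_n M) (h : G) (q : M) (B : set M) :
  chart_dom c q -> act h q = q -> nbhs q B ->
  \forall g \near h & r \near 0^'+, forall x, ball (c q) r x ->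
    (c @` chart_dom c) x /\ B (act g (chart_inv c x)).
Proof.
move=> cq hq Bq; have cx : (c @` chart_dom c) (c q) by exists q.
have : \forall g \near h & x \near c q,
    (c @` chart_dom c) x /\ B (act g (chart_inv c x)).
  apply: filterI.
    exact: (@filter_prod2 _ _ _ _ _ _ (near_chart_img cx)).
  rewrite -[q]hq in Bq.
  have [[/= P Q] [Ph Qq] PQ] := @smooth_action_continuous (h, q) _ Bq.
  exists (P, chart_inv c @^-1` Q) => [|[g x] [/= Pg Qx]];
    last exact: (PQ (_, _)).
  split => //=; apply: (chart_inv_continuous cx).
  by rewrite chart_funK.
move=> [[/= P Q] [Ph /nbhs_ballP[s /= s0 sQ]] PQ].
exists (P, [set r | r < s]).
  by split => //=; exact: nbhs_right_lt.
move=> [g r] [/= Pg rs] x xr; apply: (PQ (g, x)); split => //=; apply: sQ.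
by apply: le_ball xr; exact: ltW.
Qed.

Lemma act_near_linear (c : chart 'rV[R]_n M) (h : G) (q : M) (eps : R) :
  atlas M c -> chart_dom c q -> act h q = q -> 0 < eps ->
  \forall g \near h & r \near 0^'+, forall x y,
    ball (c q) r x -> ball (c q) r y ->
    `|local_rep c (act g) y - local_rep c (act g) x -
      'D_(y - x) (local_rep c (act g)) (c q)| <= eps * `|y - x|.
Proof.
move=> cM cq hq eps0; have [e [A [eh Aop AE C1]]] := smooth_action_C1 h cM.
have Aq : A (e h, c q).
  by apply/AE => //; split; [exists q|rewrite chart_funK// hq].
have [[/= P Q] [Ph Q0] PQ] := C1_family_linear_approx Aop Aq C1 eps0.
exists (e @^-1` P `&` chart_dom e, Q).
  split => //=; apply: filterI; last exact: near_chart_dom.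
  exact: (chart_fun_continuous eh).
move=> [g r] [/= [Pg eg] Qr] x y xr yr.
have := PQ (e g, r) (conj Pg Qr) x y xr yr.
by rewrite /= chart_funK.
Qed.

Lemma smooth_action1 (x : M) : act 1%g x = x.
Proof. by case: act_smooth => -[]. Qed.

Lemma smooth_actionM (g h : G) (x : M) : act (g * h)%g x = act g (act h x).
Proof. by case: act_smooth => -[]. Qed.

Lemma stabilizerX (g : G) (q : M) (k : nat) :
  act g q = q -> act (g ^+ k)%g q = q.
Proof.
move=> gq; elim: k => [|k IH]; first by rewrite expg0 smooth_action1.
by rewrite expgS smooth_actionM IH.
Qed.

Lemma local_rep_dom_fixed (c : chart 'rV[R]_n M) (g : G) (q : M) :
  chart_dom c q -> act g q = q -> local_rep_dom c (act g) (c q).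
Proof. by move=> cq gq; split; [exists q|rewrite chart_funK// gq]. Qed.

Lemma local_rep_actX (c : chart 'rV[R]_n M) (g : G) (k : nat) (x : 'rV[R]_n) :
  chart_dom c (act g (chart_inv c x)) ->
  local_rep c (act (g ^+ k.+1)%g) x =
  local_rep c (act (g ^+ k)%g) (local_rep c (act g) x).
Proof.
by move=> gx; rewrite /local_rep /= expgSr smooth_actionM chart_funK.
Qed.

(** Induction on [k] by the chain rule at the fixed point [c q]. *)
Lemma derive_local_rep_actX (c : chart 'rV[R]_n M) (g : G) (q : M) (k : nat) :
  atlas M c -> chart_dom c q -> act g q = q ->
  (forall w, 'D_w (local_rep c (act g)) (c q) = w) ->
  forall w, 'D_w (local_rep c (act (g ^+ k)%g)) (c q) = w.
Proof.
move=> cM cq gq gid; have cqi : (c @` chart_dom c) (c q) by exists q.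
elim: k => [|k IH] w.
  (* The representative of the unit is known to be the identity only on the image of the chart,
     which is a neighbourhood of [c q]. *)
  rewrite (@near_eq_derive _ _ _ _ id) ?derive_id//.
  apply: filterS (near_chart_img cqi) => u cu.
  by rewrite /local_rep /= expg0 smooth_action1 chart_invK.
have gcq : local_rep c (act g) (c q) = c q.
  by rewrite /local_rep /= chart_funK// gq.
have dX j : differentiable (local_rep c (act (g ^+ j)%g)) (c q).
  apply: (local_rep_act_C1 _ cM).1; apply: local_rep_dom_fixed => //.
  exact: stabilizerX.
have dg : differentiable (local_rep c (act g)) (c q).
  by rewrite -[g]expg1.
rewrite (@near_eq_derive _ _ _ _
  (local_rep c (act (g ^+ k)%g) \o local_rep c (act g))); last first.
  have ginv : {for c q, continuous (fun u => act g (chart_inv c u))}.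
    apply: continuous_comp; first exact: chart_inv_continuous.
    exact: smooth_action_continuousr.
  have : \forall u \near c q, chart_dom c (act g (chart_inv c u)).
    by apply: ginv; rewrite /= chart_funK// gq; exact: near_chart_dom.
  by apply: filterS => u; exact: local_rep_actX.
by rewrite derive_comp// gcq// gid IH.
Qed.

Lemma act_fixes_nbhs (c : chart 'rV[R]_n M) (g : G) (q : M) :
  compact (stabilizer act q) -> atlas M c -> chart_dom c q -> act g q = q ->
  (forall w, 'D_w (local_rep c (act g)) (c q) = w) ->
  \forall p \near q, act g p = p.
Proof.
move=> cptK cM cq gq gid.
have gK k : stabilizer act q (g ^+ k)%g by exact: stabilizerX.
have /compact_near_coveringP nearK := cptK.
have half0 : 0 < 2^-1 :> R by rewrite invr_gt0.
(* Compactness gives two radii valid for the whole stabilizer: [s], on which its elements are nearly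
   linear, and then [r], such that they map the [r]-ball into the [s]-ball. *)
pose linear_on (r : R) (h : G) := forall x y,
  ball (c q) r x -> ball (c q) r y ->
  `|local_rep c (act h) y - local_rep c (act h) x -
    'D_(y - x) (local_rep c (act h)) (c q)| <= 2^-1 * `|y - x|.
have [s s0 Hs] : exists2 s : R, 0 < s & stabilizer act q `<=` linear_on s.
  have nearL : \forall r \near 0^'+, stabilizer act q `<=` linear_on r.
    by apply: nearK => h hq; exact: act_near_linear.
  have /filter_ex[s []] : \forall r \near (0 : R)^'+, 0 < r /\
      stabilizer act q `<=` linear_on r.
    by apply: filterI => //; exact: nbhs_right_gt.
  by exists s.
pose into_ball (r : R) (h : G) := forall x, ball (c q) r x ->
  (c @` chart_dom c) x /\ (chart_dom c (act h (chart_inv c x)) /\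
    ball (c q) s (local_rep c (act h) x)).
have [r r0 Hr] : exists2 r : R, 0 < r & stabilizer act q `<=` into_ball r.
  have Bq : \forall p \near q, chart_dom c p /\ ball (c q) s (c p).
    apply: filterI; first exact: near_chart_dom.
    by apply: (chart_fun_continuous cq); exact: nbhsx_ballx.
  have nearB : \forall r \near 0^'+, stabilizer act q `<=` into_ball r.
    by apply: nearK => h hq; exact: (act_near_ball cq hq Bq).
  have /filter_ex[r []] : \forall r \near (0 : R)^'+, 0 < r /\
      stabilizer act q `<=` into_ball r.
    by apply: filterI => //; exact: nbhs_right_gt.
  by exists r.
have fixball x : ball (c q) r x -> local_rep c (act g) x = x.
  move=> xr; pose z k := local_rep c (act (g ^+ k)%g) x.
  have [cx _] := Hr _ (gK 0%N) _ xr.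
  have zs k : ball (c q) s (z k) by have [_ []] := Hr _ (gK k) _ xr.
  have z0 : z 0%N = x.
    by rewrite /z /local_rep /= expg0 smooth_action1 chart_invK.
  have z1 : z 1%N = local_rep c (act g) x by rewrite /z expg1.
  have zS k : z k.+1 = local_rep c (act (g ^+ k)%g) (z 1%N).
    rewrite z1; apply: local_rep_actX.
    by have [_ [+ _]] := Hr _ (gK 1%N) _ xr; rewrite expg1.
  (* The near-linearity of [g ^+ k] is applied to the pair [x], [z 1]; since the derivative of
     [g ^+ k] at [c q] is the identity, the linear term is [z 1 - x]. *)
  have zstep k : `|z k.+1 - z k - (z 1%N - x)| <= 2^-1 * `|z 1%N - x|.
    have := Hs _ (gK k) x (z 1%N).
    rewrite (derive_local_rep_actX k cM cq gq gid) -zS -/(z k).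
    by apply; [rewrite -z0|].
  apply/eqP; rewrite -z1 -subr_eq0; apply/eqP.
  (* All [z k] lie in the ball of radius [s] around [c q], so any two are within [2 * s]. *)
  apply: (bounded_near_arithmetic (b := 2 * s) zstep) => k.
  rewrite -(subrKA (c q)); apply: (le_trans (ler_normD _ _)).
  have := zs k; have := zs 0%N; rewrite -ball_normE /ball_ /= (distrC _ (z k)).
  lra.
have nq : \forall p \near q, ball (c q) r (c p).
  by apply: (chart_fun_continuous cq); exact: nbhsx_ballx.
near=> p.
have cp : chart_dom c p by near: p; exact: near_chart_dom.
have pr : ball (c q) r (c p) by near: p.
have := fixball _ pr; rewrite /local_rep /= chart_funK// => e.
(* The point [act g p] is in the chart domain, where equal coordinates force equal points. *)
have [_ []] := Hr _ (gK 1%N) _ pr; rewrite expg1 chart_funK// => cgp _.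
by rewrite -[LHS](chart_funK cgp) e chart_funK.
Unshelve. all: by end_near. Qed.

Lemma interior_fixed_clopen (g : G) :
  (forall q, compact (stabilizer act q)) ->
  clopen [set p | act g p = p]°.
Proof.
move=> cptK; split; first exact: open_interior.
move=> x Ax.
have gx : act g x = x.
  apply: (eq_closure_continuous (@manifold_hausdorff _ _ M) _ _ Ax).
  - exact: smooth_action_continuousr.
  - exact: cvg_id.
  - by near=> y; exact: interior_subset.
have [c cM cx] := atlas_cover x.
(* It remains to see that the derivative at [x] is the identity: it is so at nearby interior fixed
   points, and it depends continuously on the point. *)
apply: (act_fixes_nbhs (cptK x) cM cx gx) => w.
have [_ /(_ w) cD] := local_rep_act_C1 g cM.
apply: (@eq_closure_continuous M 'rV[R]_n
  ('D_w (local_rep c (act g)) \o c) (cst w) _ x _ _ _ Ax).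
- exact: norm_hausdorff.
- apply: continuous_comp; first exact: chart_fun_continuous.
  by apply: cD; exact: local_rep_dom_fixed.
- exact: cvg_cst.
near=> y => Ay.
have cy : chart_dom c y by near: y; exact: near_chart_dom.
rewrite /= (@near_eq_derive _ _ _ _ id) ?derive_id//.
have cyi : (c @` chart_dom c) (c y) by exists y.
have fixy : \forall u \near c y, act g (chart_inv c u) = chart_inv c u.
  apply: (@near_fun _ _ _ _ (fun p => act g p = p)).
    exact: chart_inv_continuous.
  by rewrite chart_funK.
apply: filterS2 fixy (near_chart_img cyi) => u gu cu.
by rewrite /local_rep /= gu chart_invK.
Unshelve. all: by end_near. Qed.

End SmoothAction.

(** * Jets of local diffeomorphisms *)

(** The derivative of [psi] is onto because [psi \o inv] is the identity near [psi 0]: by the chain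
    rule, the derivative of [inv] supplies the preimage of [w]. *)
Lemma local_diffeo0_chart (R : realType) (n : nat) (M : manifoldType R n)
    (psi : 'rV[R]_n -> M) (c : chart 'rV[R]_n M) :
  local_diffeo0 psi -> atlas M c -> chart_dom c (psi 0) ->
  [/\ {for 0, continuous psi}, differentiable (c \o psi) 0 &
      forall w, exists v, 'D_v (c \o psi) 0 = w].
Proof.
move=> [U [inv [[Uop U0] imop psiK [psic psiS] [_ invS]]]] cM cp.
have cpi : (c @` chart_dom c) (c (psi 0)) by exists (psi 0).
have dpsi : differentiable (c \o psi) 0.
  by apply: (psiS (@id_chart _ _) c _ _ 1%N).1 => //; exists 0.
have dinv : differentiable (inv \o chart_inv c) (c (psi 0)).
  apply: (invS c (@id_chart _ _) _ _ 1%N).1 => //.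
  by exists (psi 0) => //; do 2!split => //; exists 0.
have inv0 : (inv \o chart_inv c) (c (psi 0)) = 0.
  by rewrite /= chart_funK// psiK.
split=> // [|w]; first exact: psic.
exists ('D_w (inv \o chart_inv c) (c (psi 0))).
have dpsi' : differentiable (c \o psi) ((inv \o chart_inv c) (c (psi 0))).
  by rewrite inv0.
rewrite -[X in 'D__ _ X = _]inv0 -(derive_comp w dinv dpsi').
rewrite (@near_eq_derive _ _ _ _ id) ?derive_id//.
have nU : \forall u \near c (psi 0), (psi @` U) (chart_inv c u).
  apply: (chart_inv_continuous cpi); rewrite chart_funK//.
  by apply: open_nbhs_nbhs; split => //; exists 0.
apply: filterS2 nU (near_chart_img cpi) => u [v Uv vu] cu.
by rewrite /= -vu psiK// vu chart_invK.
Qed.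

(** A representative [phi] of [J] lies in the union defining [prolong k f J]. This yields some [psi]
    in [J] with [phi] in the jet of [f \o psi], and the jets of [f \o psi], [phi] and [psi]
    agree. *)
Lemma prolong_stable_jet (R : realType) (n : nat) (M : manifoldType R n)
    (k : nat) (f : M -> M) (J : set ('rV[R]_n -> M)) :
  frame_bundle M k J -> prolong k f J = J ->
  exists2 psi, local_diffeo0 psi & same_jet0 k (f \o psi) psi.
Proof.
move=> [phi phiD ->] fJ.
have : jet0 k phi phi by split.
rewrite -{1}fJ => -[psi [psiD [pp pj]] [_ [fp fj]]].
exists psi => //; split; first by rewrite fp.
move=> c cM cf vs vsk; rewrite fj// pj//.
by rewrite -fp.
Qed.

Lemma prolong_id (R : realType) (n : nat) (M : manifoldType R n)
    (k : nat) (J : set ('rV[R]_n -> M)) :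
  frame_bundle M k J -> prolong k id J = J.
Proof.
move=> [phi _ ->]; apply/seteqP; split => psi.
  move=> [chi [_ [pc jc]] [psiD [cp cj]]]; split => //.
  split; first by rewrite pc.
  move=> c cM cphi vs vsk; rewrite jc// -cj//.
  by rewrite /= -pc.
by move=> Jpsi; exists psi => //; split => //; exact: Jpsi.1.
Qed.

(** By the chain rule the derivative of [f] composed with that of [psi] equals that of [psi], which
    is onto and so can be cancelled. *)
Lemma jet_fixed_derive (R : realType) (n : nat) (M : manifoldType R n)
    (f : M -> M) (psi : 'rV[R]_n -> M) (c : chart 'rV[R]_n M) (k : nat) :
  (0 < k)%N -> local_diffeo0 psi -> same_jet0 k (f \o psi) psi ->
  atlas M c -> chart_dom c (psi 0) ->
  differentiable (local_rep c f) (c (psi 0)) ->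
  forall w, 'D_w (local_rep c f) (c (psi 0)) = w.
Proof.
move=> k0 psiD [fp fj] cM cp df w.
have [psic dpsi /(_ w)[v vw]] := local_diffeo0_chart psiD cM cp.
(* The one-term list [[:: v]] extracts the first derivative from the jet; its length is allowed
   because [0 < k]. *)
have fv : 'D_v (c \o (f \o psi)) 0 = w.
  by rewrite -[RHS]vw; apply: (fj c cM _ [:: v] k0); rewrite fp.
rewrite -[RHS]fv.
rewrite [RHS](@near_eq_derive _ _ _ _ (local_rep c f \o (c \o psi)));
  last first.
  have : \forall u \near (0 : 'rV[R]_n), chart_dom c (psi u).
    by apply: psic; exact: near_chart_dom.
  by apply: filterS => u cu; rewrite /local_rep /= chart_funK.
by rewrite (derive_comp v dpsi df) vw.
Qed.

Theorem corollary5p4 (R : realType) (d n : nat) (G : lieGroupType R d)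
    (M : manifoldType R n) (act : G -> M -> M)
    (act_smooth : smooth_action act)
    (act_effective : component_effective act)
    (stab_compact : forall q : M, compact (stabilizer act q))
    (l : nat) (l_gt0 : (0 < l)%N) :
  free_on (fun g : G => prolong l (act g)) (frame_bundle M l).
Proof.
(* Freeness is an equality of sets; the inclusion of the unit in the stabilizer is settled first. *)
move=> J FJ; apply/seteqP; split => [g gJ|_ ->]; last first.
  rewrite /stabilizer/= (_ : act 1%g = id) ?prolong_id//.
  by apply/funext => x; exact: smooth_action1.
apply: contrapT => g1.
have [psi psiD psij] := prolong_stable_jet FJ gJ.
have gp : act g (psi 0) = psi 0 := psij.1.
have [c cM cp] := atlas_cover (psi 0).
(* Effectiveness provides a point moved by [g] in the component of [psi 0]; the contradiction is
   that this component lies in the interior of the fixed point set. *)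
have [x Cx] := act_effective _ g1 _ (ex_intro _ (psi 0) erefl).
apply; apply: (@interior_subset M [set p | act g p = p]).
have clop := interior_fixed_clopen act_smooth g stab_compact.
apply: (connected_component_clopen clop _ Cx).
apply: (act_fixes_nbhs act_smooth (stab_compact _) cM cp gp).
apply: (jet_fixed_derive l_gt0 psiD psij cM cp).
apply: (local_rep_act_C1 act_smooth g cM).1.
exact: local_rep_dom_fixed.
Qed.
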